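(* Let $T$ be any minimal increasing tableau of type A, i.e. $T=M_{\nu/\lambda}$ for some skew shape $\nu/\lambda$ in $\mathbb{N}^2$. Then the greedy rectification $\mathrm{rect}(T)$ is a minimal increasing tableau.
   Context: **Type A.** Let $\Lambda=\mathbb{N}^2$ ($\mathbb{N}=\{1,2,3,\dots\}$), whose elements $[r,c]$ are boxes in row $r$ (rows numbered top to bottom) and column $c$ (columns numbered left to right), with partial order $[r_1,c_1]\le[r_2,c_2]$ iff $r_1\le r_2$ and $c_1\le c_2$. A straight shape is a finite lower order ideal of $\mathbb{N}^2$; a skew shape is $\nu/\lambda:=\nu\setminus\lambda$ with $\lambda\subset\nu$ straight shapes. An increasing tableau is a map $T:\nu/\lambda\to\mathbb{Z}$ on a skew shape with $T(\alpha)<T(\beta)$ whenever $\alpha<\beta$. The minimal increasing tableau $M_{\nu/\lambda}$ of skew shape $\nu/\lambda$ sends each box $\alpha\in\nu/\lambda$ to the maximal cardinality of a totally ordered subset of $\nu/\lambda$ with $\alpha$ as its largest element (straight shapes are the case $\lambda=\emptyset$). **Slides and greedy rectification.** Two boxes are neighbors if one covers the other. For a tableau $Y$ with values in a set $S$ and $s,s'\in S$, $\mathrm{swap}_{s,s'}(Y)$ is the tableau of the same shape sending $\alpha$ to $s'$ if $Y(\alpha)=s$ and $Y(\beta)=s'$ for some neighbor $\beta$ of $\alpha$; to $s$ if $Y(\alpha)=s'$ and $Y(\beta)=s$ for some neighbor $\beta$ of $\alpha$; and to $Y(\alpha)$ otherwise. If $T$ is increasing of shape $\nu/\lambda$ with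 values in $[a,b]$ and $C$ is a set of maximal boxes of $\lambda$, the forward slide $\mathrm{jdt}_C(T)$ is obtained by adding the boxes of $C$ filled with $\bullet$, applying $\mathrm{swap}_{a,\bullet},\mathrm{swap}_{a+1,\bullet},\dots,\mathrm{swap}_{b,\bullet}$ in this order, and deleting all boxes containing $\bullet$; it is an increasing tableau of shape $\nu'/(\lambda\setminus C)$ for some straight shape $\nu'$. For an increasing tableau $T$ of shape $\nu/\lambda$: if $\lambda=\emptyset$ then $\mathrm{rect}(T)=T$; otherwise $\mathrm{rect}(T)=\mathrm{rect}(\mathrm{jdt}_C(T))$, where $C$ is the set of all maximal boxes of $\lambda$. *)

(* Defs.v *)
From HB Require Import structures.
From mathcomp Require Import all_boot all_order all_algebra finmap zify.
From mathcomp Require Import boolp.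

Set Implicit Arguments.
Unset Strict Implicit.
Unset Printing Implicit Defensive.

Import Order.TTheory GRing.Theory Num.Theory Order.ProdSyntax.

Local Open Scope order_scope.
Local Open Scope fset_scope.
Local Open Scope fmap_scope.

(* The pair (r, c) is the box in row r and column c, ordered componentwise.
   Rows and columns are numbered from 0 instead of 1, which is an isomorphism
   of posets. *)
Definition box := (nat *p nat)%type.

Definition straight_shape (lam : {fset box}) : Prop :=
  forall x y : box, x <= y -> y \in lam -> x \in lam.

(* nu `\` lam is a skew shape.  The inner shape lam is not determined by the
   set of boxes nu `\` lam, so it is always carried along. *)
Definition skew_shape (nu lam : {fset box}) : Prop :=
  [/\ straight_shape nu, straight_shape lam & lam `<=` nu].

(* A filling of a finite set of boxes is a finite map whose domain is that
   set. *)
Definition increasing (T : {fmap box -> int}) : Prop :=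
  forall x y : domf T, val x < val y -> (T x < T y)%R.

Definition covers (y x : box) : Prop :=
  x < y /\ ~ exists z : box, x < z /\ z < y.

Definition neighbors (x y : box) : Prop := covers y x \/ covers x y.

Definition chain (C : {fset box}) : bool :=
  [forall x : C, forall y : C, val x >=< val y].

Definition largest (a : box) (C : {fset box}) : bool :=
  (a \in C) && [forall x : C, val x <= a].

Definition min_tableau (nu lam : {fset box}) : {fmap box -> int} :=
  [fmap a : nu `\` lam =>
     Posz (\max_(C <- fpowerset (nu `\` lam) | chain C && largest (val a) C)
             #|` C|)].

Definition has_neighbor (S : eqType) (Y : {fmap box -> S}) (a : domf Y)
    (s : S) : bool :=
  [exists b : domf Y, `[< neighbors (val a) (val b) >] && (Y b == s)].

Definition swap (S : eqType) (s s' : S) (Y : {fmap box -> S}) :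
    {fmap box -> S} :=
  [fmap a : domf Y =>
     if (Y a == s) && has_neighbor a s' then s'
     else if (Y a == s') && has_neighbor a s then s
     else Y a].

Definition maximal_boxes (lam : {fset box}) : {fset box} :=
  [fset x in lam | [forall y : lam, ~~ (x < val y)]].

(* Here and below, None stands for the bullet: a box of C outside of the
   domain of T is sent to T.[? x] = None. *)
Definition add_bullets (C : {fset box}) (T : {fmap box -> int}) :
    {fmap box -> option int} :=
  [fmap x : domf T `|` C => T.[? val x]].

(* a, a + 1, ..., b *)
Definition int_range (a b : int) : seq int :=
  if (a <= b)%R then [seq (a + Posz i)%R | i <- iota 0 `|b - a|%N.+1] else [::].

(* reducef deletes the boxes sent to None. *)
Definition jdt_range (a b : int) (C : {fset box}) (T : {fmap box -> int}) :
    {fmap box -> int} :=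
  reducef (foldl (fun Y i => swap (Some i) None Y) (add_bullets C T)
                 (int_range a b)).

Definition values_in (a b : int) (T : {fmap box -> int}) : Prop :=
  forall x : domf T, (a <= T x <= b)%R.

Definition max_abs (T : {fmap box -> int}) : nat :=
  \max_(x : domf T) `|T x|%N.

(* The slide for one particular interval containing the values of T; by
   jdtE below, any other such interval gives the same result. *)
Definition jdt (C : {fset box}) (T : {fmap box -> int}) : {fmap box -> int} :=
  jdt_range (- Posz (max_abs T))%R (Posz (max_abs T)) C T.

(* n is fuel; rectE below is the defining equation of the rectification. *)
Fixpoint rect_rec (n : nat) (lam : {fset box}) (T : {fmap box -> int}) :
    {fmap box -> int} :=
  if n is n'.+1 then
    if lam == fset0 then T
    else rect_rec n' (lam `\` maximal_boxes lam) (jdt (maximal_boxes lam) T)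
  else T.

Definition rect (lam : {fset box}) (T : {fmap box -> int}) :
    {fmap box -> int} := rect_rec #|` lam| lam T.

Lemma int_rangeE a b i : (i \in int_range a b) = (a <= i <= b)%R.
Proof.
rewrite /int_range; case: ifPn => ab; last by rewrite in_nil; lia.
apply/mapP/idP => [[k]|/andP[ai ib]].
  by rewrite mem_iota => /andP[_ kn] ->; lia.
by exists `|i - a|%N; rewrite ?mem_iota; lia.
Qed.

Lemma int_range_sorted a b : sorted (fun i j : int => i < j)%R (int_range a b).
Proof.
rewrite /int_range; case: ifPn => // _.
rewrite sorted_map; apply: sub_sorted (iota_ltn_sorted _ _) => i j /=.
by rewrite /relpre /=; lia.
Qed.

Definition has_value (V : {pred int}) (Y : {fmap box -> option int}) :=
  forall (x : domf Y) i, Y x = Some i -> i \in V.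

Lemma has_value_swap V i Y :
  i \in V -> has_value V Y -> has_value V (swap (Some i) None Y).
Proof.
move=> iV YV x j; have := YV x j; rewrite ffunE; case: ifP => // _.
by case: ifP => // _ _ [<-].
Qed.

Lemma swap_id i V Y : i \notin V -> has_value V Y -> swap (Some i) None Y = Y.
Proof.
move=> iV YV; have Yi (x : domf Y) : Y x == Some i = false.
  by apply/negP => /eqP/YV; apply/negP.
have ni (x : domf Y) : has_neighbor x (Some i) = false.
  by apply/existsP => -[y]; rewrite Yi andbF.
by apply/fmapP => k; case: fndP => kY; rewrite ?ffunE /=;
  [rewrite Yi ni andbF /= in_fnd | rewrite not_fnd].
Qed.

Lemma jdtE a b C T : values_in a b T -> jdt C T = jdt_range a b C T.
Proof.
move=> Tab; pose V := [pred i : int | [exists x : domf T, T x == i]].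
have bulletV : has_value V (add_bullets C T).
  move=> x i; rewrite ffunE; case: fndP => // xT [<-].
  by apply/existsP; exists [` xT].
have foldV s Y : has_value V Y ->
    foldl (fun Y i => swap (Some i) None Y) Y s =
    foldl (fun Y i => swap (Some i) None Y) Y [seq i <- s | i \in V].
  elim: s Y => //= i s IH Y YV; case: ifPn => iV /=.
    by apply: IH; exact: has_value_swap.
  by rewrite (swap_id iV YV); exact: IH.
rewrite /jdt /jdt_range [in LHS]foldV // [in RHS]foldV //.
congr (reducef (foldl _ _ _)).
apply: (@irr_sorted_eq _ (fun i j : int => i < j)%R).
- by move=> ? ? ?; exact: lt_trans.
- by move=> ?; exact: ltxx.
- by apply: sorted_filter (int_range_sorted _ _) => ? ? ?; exact: lt_trans.
- by apply: sorted_filter (int_range_sorted _ _) => ? ? ?; exact: lt_trans.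
move=> i; rewrite !mem_filter; case: (boolP (i \in V)) => //= /existsP[x /eqP<-].
rewrite !int_rangeE Tab.
have := @leq_bigmax _ (fun x : domf T => `|T x|%N) x; rewrite -/(max_abs T).
by move: (T x) => t; lia.
Qed.

Lemma maximal_boxes_neq0 lam : lam != fset0 -> maximal_boxes lam != fset0.
Proof.
have lt_box (u v : box) : u < v -> (u.1 + u.2 < v.1 + v.2)%N.
  case: u v => [a b] [c d]; rewrite lt_neqAle leEprod => /andP[ne /andP[ac bd]].
  have {}ac : (a <= c)%N := ac; have {}bd : (b <= d)%N := bd.
  have : (a != c) || (b != d) by rewrite -negb_and; exact: ne.
  by rewrite /=; lia.
case/fset0Pn=> x0 x0lam.
pose m (x : lam) := ((val x).1 + (val x).2)%N.
case: (arg_maxnP m (isT : xpredT [` x0lam])) => x _ xmax.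
apply/fset0Pn; exists (val x); rewrite !inE /= fsvalP /=.
apply/forallP => y; apply/negP => /lt_box; rewrite ltnNge => /negP.
by apply; exact: xmax.
Qed.

Lemma rectE lam T :
  rect lam T = if lam == fset0 then T
               else rect (lam `\` maximal_boxes lam)
                         (jdt (maximal_boxes lam) T).
Proof.
have lt l : l != fset0 -> (#|` l `\` maximal_boxes l| < #|` l|)%N.
  move=> l0; have /fset0Pn[x xm] := maximal_boxes_neq0 l0.
  have xl : x \in l by move: xm; rewrite inE => /andP[].
  apply: fproper_ltn_card; rewrite /fproper fsubsetDl /=.
  by apply/negP => /fsubsetP/(_ x xl); rewrite inE xm.
have H n m l U : (#|` l| <= n)%N -> (#|` l| <= m)%N ->
    rect_rec n l U = rect_rec m l U.
  elim: n m l U => [|n IH] [|m] l U //=.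
  - by rewrite leqn0 cardfs_eq0 => ->.
  - by rewrite leqn0 cardfs_eq0 => _ ->.
  case: ifPn => // l0 ln lm.
  by apply: IH; rewrite -ltnS; exact: leq_trans (lt _ l0) _.
rewrite {1}/rect; case: ifPn => [/eqP->|lam0]; first by rewrite cardfs0.
have := lt _ lam0; case: #|` lam| => // k lek /=.
by rewrite (negPf lam0); exact: H.
Qed.

Lemma increasing_min_tableau nu lam : increasing (min_tableau nu lam).
Proof.
move=> x y xy; rewrite !ffunE ltz_nat; set M := (X in (_ < X)%N).
have key (C : {fset box}) : C `<=` nu `\` lam -> chain C ->
    (forall u, u \in C -> u < val y) -> (#|` C| < M)%N.
  move=> CD chC Cy.
  have yC : val y \notin C by apply/negP => /Cy; rewrite ltxx.
  rewrite -add1n -[1%N]/(nat_of_bool true) -yC -cardfsU1 /M.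
  have le_y u : u \in val y |` C -> u <= val y.
    by rewrite in_fset1U => /orP[/eqP->//|/Cy/ltW].
  apply: leq_bigmax_seq; first by rewrite fpowersetE fsubUset fsub1set fsvalP.
  apply/andP; split; last first.
    by rewrite /largest in_fset1U eqxx; apply/forallP => u; exact/le_y/fsvalP.
  have cmp u v : u \in val y |` C -> v \in val y |` C -> u >=< v.
    move=> uyC vyC; move: (uyC) (vyC); rewrite !in_fset1U.
    move=> /orP[/eqP->|uC]; first by rewrite ge_comparable ?le_y.
    move=> /orP[/eqP->|vC]; first by rewrite le_comparable ?le_y.
    exact: (forallP (forallP chC [` uC]) [` vC]).
  by apply/forallP => u; apply/forallP => v; apply: cmp; exact: fsvalP.
have M_gt0 : (0 < M)%N.
  apply: leq_ltn_trans (leq0n _) (key fset0 (fsub0set _) _ _).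
    by apply/forallP => u; have := fsvalP u; rewrite in_fset0.
  by move=> u; rewrite in_fset0.
rewrite -(prednK M_gt0) ltnS; apply/bigmax_leqP_seq => C.
rewrite fpowersetE => CD /andP[chC /andP[_ /forallP Cx]].
rewrite -ltnS (prednK M_gt0); apply: key => // u uC.
exact: le_lt_trans (Cx [` uC]) xy.
Qed.

(* Main.v *)
(* Call (m, n, a)-rectangle a family of boxes p i j with i <= m and j <= n such
   that p i j contains a + i + j, the columns increase in j and the rows
   increase in i.

   A slide creates and destroys no rectangles.  When the entries a and the
   bullets are swapped, an entry a of a rectangle that moves can follow a bullet
   to the left or upwards (backwards in time: to the right or downwards).  If
   one direction breaks the inequalities, then the other one does not.

   In a minimal increasing tableau every (m, n, a + 1)-rectangle with a >= 1
   can be pushed to an (m, n, a)-rectangle, since every entry v > 1 has v - 1 to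
   its left or above it.

   An increasing tableau of straight shape with positive entries in which
   rectangles can be pushed down in this way is minimal: an entry that is larger
   than in the minimal tableau is the corner of a rectangle that cannot be
   pushed down. *)
Require Import Defs.
From mathcomp Require Import all_boot all_order all_algebra finmap zify.
From mathcomp Require Import boolp.

Set Implicit Arguments.
Unset Strict Implicit.
Unset Printing Implicit Defensive.

Import Order.TTheory GRing.Theory Num.Theory Order.ProdSyntax.

Local Open Scope fset_scope.
Local Open Scope fmap_scope.

(** * Order and covers of boxes in coordinates *)

Lemma box_leE (x y : box) : (x <= y)%O = (x.1 <= y.1)%N && (x.2 <= y.2)%N.
Proof. by rewrite leEprod. Qed.

Lemma box_ltE (x y : box) :
  (x < y)%O = [&& x.1 <= y.1, x.2 <= y.2 & x.1 + x.2 < y.1 + y.2]%N.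
Proof.
rewrite lt_neqAle box_leE; case: x y => [a b] [c d] /=.
have -> : ((a, b) != (c, d) :> box) = (a != c) || (b != d) by rewrite -negb_and.
by lia.
Qed.

Lemma predn_of_ltn k l : (k < l)%N -> ~~ (k < l.-1)%N -> k = l.-1.
Proof. by lia. Qed.

Lemma succn_of_ltn k l : (k < l)%N -> ~~ (k.+1 < l)%N -> k.+1 = l.
Proof. by lia. Qed.

Lemma box_lt_left (x : box) : (0 < x.2)%N -> (((x.1, x.2.-1) : box) < x)%O.
Proof. by case: x => a b; rewrite box_ltE /=; lia. Qed.

Lemma box_lt_up (x : box) : (0 < x.1)%N -> (((x.1.-1, x.2) : box) < x)%O.
Proof. by case: x => a b; rewrite box_ltE /=; lia. Qed.

Lemma coversP (y x : box) :
  covers y x <-> y = (x.1.+1, x.2) \/ y = (x.1, x.2.+1).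
Proof.
rewrite /covers box_ltE; case: x y => [a b] [c d] /=; split; last first.
  by case=> -[-> ->]; (split; [lia | case=> -[e f]; rewrite !box_ltE /=; lia]).
case=> lt_xy no_mid.
have ne (e f : nat) : ((c, d) : box) <> (e, f) -> (c != e) || (d != f).
  by move=> /eqP; rewrite xpair_eqE negb_and.
have [lt_ac|ge_ac] := ltnP a c; [left | right]; apply: contra_notP no_mid.
- by move/ne=> {}ne; exists (a.+1, b); rewrite !box_ltE /=; lia.
- by move/ne=> {}ne; exists (a, b.+1); rewrite !box_ltE /=; lia.
Qed.

(** * Rectangles under a single swap *)

Definition convex (D : {fset box}) :=
  forall x y z : box, x \in D -> z \in D -> (x <= y)%O -> (y <= z)%O -> y \in D.

(** The indices [m] and [n] are the last ones, so a single entry is the case [m = n = 0]. Positions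
    with the same [i + j] are allowed to share a box. *)
Definition rectangle (h : box -> option int) (m n : nat) (a : int) : Prop :=
  exists p : nat -> nat -> box,
    [/\ forall i j, (i <= m)%N -> (j <= n)%N -> h (p i j) = Some (a + i%:Z + j%:Z)%R,
        forall i j, (i <= m)%N -> (j < n)%N -> ((p i j).2 < (p i j.+1).2)%N
      & forall i j, (i < m)%N -> (j <= n)%N -> ((p i j).1 < (p i.+1 j).1)%N].

(* Before the values a are swapped, the bullet lies between a - 1 and a. *)
Definition key (a : int) (u : option int) : int :=
  if u is Some v then (v *+ 2)%R else (a *+ 2 - 1)%R.

(** All bullets have the same key, so strictness also makes any two bullets in [D] incomparable. *)
Definition key_increasing (a : int) (D : {fset box}) (h : box -> option int) :=
  forall x y : box, x \in D -> y \in D -> (x < y)%O -> (key a (h x) < key a (h y))%R.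

(* The second clause need not mention neighbors: nothing fits between a bullet
   and an entry a above it, so these boxes are neighbors. *)
Definition swapped (a : int) (D : {fset box}) (h h' : box -> option int) :=
  [/\ forall x, x \in D -> h x <> Some a -> h x <> None -> h' x = h x,
      forall x y : box, x \in D -> y \in D -> (x < y)%O ->
        h x = None -> h y = Some a -> h' x = Some a /\ h' y = None,
      forall x, x \in D -> h x = Some a ->
        h' x = Some a \/ exists y : box, [/\ y \in D, covers x y & h y = None]
    & forall x, x \in D -> h x = None ->
        h' x = None \/ exists y : box, [/\ y \in D, covers y x & h y = Some a]].

Section Swap.

Variables (a : int) (D : {fset box}) (h h' : box -> option int).
Hypotheses (Dconvex : convex D).
Hypotheses (hD : forall x v, h x = Some v -> x \in D).
Hypotheses (h'D : forall x v, h' x = Some v -> x \in D).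
Hypotheses (h_incr : key_increasing a D h) (hh' : swapped a D h h').

Lemma swapped_cases x : x \in D ->
  [\/ h' x = h x, h x = Some a /\ h' x = None | h x = None /\ h' x = Some a].
Proof.
have [other swap_ab keep_a keep_b] := hh'.
move=> xD; case hx: (h x) => [v|]; last first.
  case: (keep_b x xD hx) => [|[y [yD /coversP xy hy]]]; first by constructor 1.
  constructor 3; split=> //; have [] // := swap_ab x y xD yD _ hx hy.
  by case: xy => ->; rewrite box_ltE /=; lia.
have [ev|/eqP ne] := eqVneq v a; last first.
  by constructor 1; rewrite -hx; apply: other; rewrite // hx => // -[].
rewrite {}ev in hx *.
case: (keep_a x xD hx) => [|[y [yD /coversP xy hy]]]; first by constructor 1.
constructor 2; split=> //; have [] // := swap_ab y x yD xD _ hy hx.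
by case: xy => ->; rewrite box_ltE /=; lia.
Qed.

(** The key of a bullet rises from [2a - 1] to [2a + 1]. Only an entry [a] above a bullet could
    violate the new order, and the swap exchanges the two. *)
Lemma key_increasing_swapped : key_increasing (a + 1)%R D h'.
Proof.
have [_ swap_ab _ _] := hh'.
move=> x y xD yD xy; have := h_incr xD yD xy.
have := swap_ab x y xD yD xy.
case: (swapped_cases xD) => [->|[-> ->]|[-> ->]];
  case: (swapped_cases yD) => [->|[-> ->]|[-> ->]]; rewrite /key;
  case: (h x) => [u|]; case: (h y) => [v|]; try lia.
all: try by move=> /(_ erefl erefl) [].
all: have [->|] := eqVneq v a; first by move=> /(_ erefl erefl) [].
all: lia.
Qed.

Lemma swapped_eq x v : v != a -> h x = Some v <-> h' x = Some v.
Proof.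
move=> va; split=> hx; have := hx.
  by case: (swapped_cases (hD hx)) => [->|[-> _] [e]|[->]] //; rewrite e eqxx in va.
by case: (swapped_cases (h'D hx)) => [->|[_ ->]|[_ ->] [e]] //; rewrite e eqxx in va.
Qed.

(* A box containing a moves left or up.  Only the box diagonally above it can
   be in the way, and it obstructs both directions only if it is the image of
   two different positions of the rectangle. *)
Lemma rectangle_swapped m n b : rectangle h m n b -> rectangle h' m n b.
Proof.
have [_ swap_ab keep_a _] := hh'.
case=> p [hp Ep Sp].
have pD i j : (i <= m)%N -> (j <= n)%N -> p i j \in D.
  by move=> im jn; exact: hD (hp i j im jn).
(* Left is the preferred direction. The last conjunct keeps the column inequality with the preceding
   position, which is absent for [j = 0]. *)
pose left_ok i j := let z := p i j in
  [&& (0 < z.2)%N, (z.1, z.2.-1) \in D, h (z.1, z.2.-1) == None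
    & (j == 0)%N || ((p i j.-1).2 < z.2.-1)%N].
pose q i j : box := let z := p i j in
  if (h z == Some a) && (h' z != Some a) then
    if left_ok i j then (z.1, z.2.-1) else (z.1.-1, z.2)
  else z.
(* If the preceding position blocks the move to the left, it is the diagonal neighbor, and the box
   above is a bullet too. The keys allow only a bullet between [a - 1] and [a], and nothing between
   [a - 1] and a bullet. *)
have diag_left i j : (i <= m)%N -> (j < n)%N -> h (p i j.+1) = Some a ->
    ((p i j.+1).1, (p i j.+1).2.-1) \in D ->
    h ((p i j.+1).1, (p i j.+1).2.-1) = None ->
    (p i j).2 = (p i j.+1).2.-1 ->
    [/\ p i j = ((p i j.+1).1.-1, (p i j.+1).2.-1), (0 < (p i j.+1).1)%N, 
       ((p i j.+1).1.-1, (p i j.+1).2) \in D &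
       h ((p i j.+1).1.-1, (p i j.+1).2) = None].
  move=> im jn; have := Ep i j im jn.
  have := hp i j.+1 im jn; have := hp i j im (ltnW jn).
  have := pD i j.+1 im jn; have := pD i j im (ltnW jn).
  case: (p i j) => y1 y2; case: (p i j.+1) => z1 z2 /= yD zD hy hz y2z2 hza lD hl ey.
  have ab : (a = b + i%:Z + j%:Z + 1)%R by move: hza; rewrite hz => -[<-]; lia.
  have y1z1 : (y1 < z1)%N.
    rewrite ltnNge; apply/negP => zy.
    have [e|ne] := eqVneq z1 y1; first by move: hl; rewrite e -ey hy.
    have := h_incr lD yD; rewrite box_ltE /= hl hy /key => /(_ _) ; lia.
  have uD : (z1.-1, z2) \in D by apply: (Dconvex yD zD); rewrite box_leE /=; lia.
  have dD : (z1.-1, z2.-1) \in D by apply: (Dconvex yD lD); rewrite box_leE /=; lia.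
  have hu : h (z1.-1, z2) = None.
    have := h_incr yD uD; have := h_incr uD zD; rewrite !box_ltE /= hy hz.
    by case: (h _) => [u|//] /(_ _) k1 /(_ _) k2; rewrite /key in k1 k2; lia.
  split=> //; try lia.
  have [->//|e] := eqVneq y1 z1.-1; first by rewrite ey.
  have := h_incr yD dD; have := h_incr dD lD; rewrite !box_ltE /= hy hl.
  by case: (h _) => [u|//] /(_ _) k1 /(_ _) k2; rewrite /key in k1 k2; lia.

have diag_up i j : (i < m)%N -> (j <= n)%N -> h (p i.+1 j) = Some a ->
    ((p i.+1 j).1.-1, (p i.+1 j).2) \in D ->
    h ((p i.+1 j).1.-1, (p i.+1 j).2) = None ->
    (p i j).1 = (p i.+1 j).1.-1 ->
    [/\ p i j = ((p i.+1 j).1.-1, (p i.+1 j).2.-1), (0 < (p i.+1 j).2)%N,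
       ((p i.+1 j).1, (p i.+1 j).2.-1) \in D &
       h ((p i.+1 j).1, (p i.+1 j).2.-1) = None].
  move=> im jn; have := Sp i j im jn.
  have := hp i.+1 j im jn; have := hp i j (ltnW im) jn.
  have := pD i.+1 j im jn; have := pD i j (ltnW im) jn.
  case: (p i j) => y1 y2; case: (p i.+1 j) => z1 z2 /= yD zD hy hz y1z1 hza uD hu ey.
  have ab : (a = b + i%:Z + j%:Z + 1)%R by move: hza; rewrite hz => -[<-]; lia.
  have y2z2 : (y2 < z2)%N.
    rewrite ltnNge; apply/negP => zy.
    have [e|ne] := eqVneq z2 y2; first by move: hu; rewrite e -ey hy.
    have := h_incr uD yD; rewrite box_ltE /= hu hy /key => /(_ _) ; lia.
  have lD : (z1, z2.-1) \in D by apply: (Dconvex yD zD); rewrite box_leE /=; lia.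
  have dD : (z1.-1, z2.-1) \in D by apply: (Dconvex yD uD); rewrite box_leE /=; lia.
  have hl : h (z1, z2.-1) = None.
    have := h_incr yD lD; have := h_incr lD zD; rewrite !box_ltE /= hy hz.
    by case: (h _) => [u|//] /(_ _) k1 /(_ _) k2; rewrite /key in k1 k2; lia.
  split=> //; try lia.
  have [->//|e] := eqVneq y2 z2.-1; first by rewrite ey.
  have := h_incr yD dD; have := h_incr dD uD; rewrite !box_ltE /= hy hu.
  by case: (h _) => [u|//] /(_ _) k1 /(_ _) k2; rewrite /key in k1 k2; lia.
(* A shared box would leave a box strictly between the entries [a - 2] and [a - 1], where neither an
   integer nor a bullet fits. *)
have not_both i j : (i < m)%N -> (j < n)%N -> a = (b + i%:Z + j%:Z + 2)%R ->
    p i.+1 j <> p i j.+1.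
  move=> im jn ea e; have := Ep i j (ltnW im) jn; have := Sp i j im (ltnW jn).
  have := hp i j (ltnW im) (ltnW jn); have := hp i j.+1 (ltnW im) jn.
  have := pD i j (ltnW im) (ltnW jn); have := pD i j.+1 (ltnW im) jn.
  rewrite e; case: (p i j) => x1 x2; case: (p i j.+1) => y1 y2 /= yD xD hy hx lt1 lt2.
  have zD : (x1, y2) \in D by apply: (Dconvex xD yD); rewrite box_leE /=; lia.
  have := h_incr xD zD; have := h_incr zD yD; rewrite !box_ltE /= hx hy.
  by case: (h _) => [u|] /(_ _) k1 /(_ _) k2; rewrite /key in k1 k2; lia.
(* Comparing a moved box with the old places of its predecessors suffices, because by [q_le] moves
   never increase a coordinate. *)
have moved i j : (i <= m)%N -> (j <= n)%N ->
    (h (p i j) == Some a) && (h' (p i j) != Some a) ->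
  [/\ h' (q i j) = Some a, (0 < j)%N -> ((p i j.-1).2 < (q i j).2)%N &
    (0 < i)%N -> ((p i.-1 j).1 < (q i j).1)%N].
  move=> im jn mv; rewrite /q /= mv; case/andP: mv => /eqP hz h'z.
  have zD := hD hz.
  have ea : a = (b + i%:Z + j%:Z)%R by move: hz; rewrite hp // => -[].
  case: (boolP (left_ok i j)) => [/and4P[z0 lD /eqP hl ok]|nok].
    split=> /=.
    - by have [] := swap_ab _ _ lD zD (box_lt_left z0) hl hz.
    - by move=> j0; move: ok; rewrite eqn0Ngt j0.
    - by case: i im {ea hz h'z zD z0 lD hl ok} => // i im _; exact: Sp.
  have [uz0 uD hu] : [/\ (0 < (p i j).1)%N, ((p i j).1.-1, (p i j).2) \in D &
      h ((p i j).1.-1, (p i j).2) = None].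
    case: (keep_a _ zD hz) => [e|[y [yD /coversP yz hy]]]; first by rewrite e eqxx in h'z.
    case: yz => ez.
      by have -> : ((p i j).1.-1, (p i j).2) = y; [rewrite ez; case: (y) | rewrite ez].
    have ly : ((p i j).1, (p i j).2.-1) = y by rewrite ez; case: (y).
    move: nok; rewrite /left_ok ly yD hy eqxx ez /= => /norP[].
    case: j jn hz h'z zD ea ez ly => //= j jn hz h'z zD ea ez ly _ lt.
    have [|||_ z0 uD hu] := diag_left i j im jn hz; rewrite ?ly //.
      2: by rewrite ez in z0 uD hu.
    by have := Ep i j im jn; rewrite ez /=; lia.
  split=> /=.
  - by have [] := swap_ab _ _ uD zD (box_lt_up uz0) hu hz.
  - by case: j jn {nok hz h'z zD ea uz0 uD hu} => // j jn _; exact: Ep.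
  case: i im nok hz h'z zD ea uz0 uD hu => //= i im nok hz h'z zD ea uz0 uD hu _.
  have lt_i := Sp i j im jn.
  have [e|ne] := eqVneq ((p i j).1 : nat) (p i.+1 j).1.-1; last first.
    by rewrite ltn_neqAle ne -ltnS prednK.
  (* If the upward move is blocked as well, the predecessors in both directions sit on the same
     diagonal box, contrary to [not_both]. *)
  have [ep z2 lD hl] := diag_up i j im jn hz uD hu e.
  move: nok; rewrite /left_ok lD hl eqxx z2 /= => /norP[].
  case: j jn {lt_i} hz h'z zD ea uz0 uD hu e ep z2 lD hl => //=
    j jn hz h'z zD ea uz0 uD hu e ep z2 lD hl _ lt.
  have [|ep' _ _ _] := diag_left i.+1 j im jn hz lD hl.
    by apply: predn_of_ltn; [exact: Ep | exact: lt].
  by case: (not_both i j im jn); rewrite ?ep ?ep' // ea; lia.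
have q_le i j : ((q i j).1 <= (p i j).1)%N && ((q i j).2 <= (p i j).2)%N.
  by rewrite /q; case: ifP => _; [case: ifP => _ /=; lia | lia].
exists q; split=> i j.
- move=> im jn; case: (boolP ((h (p i j) == Some a) && (h' (p i j) != Some a))) => mv.
    by have [-> _ _] := moved i j im jn mv; case/andP: mv => /eqP; rewrite hp.
  rewrite /q (negPf mv); move: mv; rewrite hp //.
  have [->|ne] := eqVneq (Some (b + i%:Z + j%:Z)%R) (Some a).
    by rewrite /= negbK => /eqP.
  by move=> _; apply/(swapped_eq _ _); rewrite ?hp //; apply: contraNneq ne => ->.
- move=> im jn.
  case: (boolP ((h (p i j.+1) == Some a) && (h' (p i j.+1) != Some a))) => mv.
    have [_ /(_ isT) /= lt _] := moved i j.+1 im jn mv.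
    by case/andP: (q_le i j) => _ /leq_ltn_trans; apply.
  case/andP: (q_le i j) => _ /leq_ltn_trans; apply.
  by rewrite {1}/q (negPf mv); apply: Ep.
- move=> im jn.
  case: (boolP ((h (p i.+1 j) == Some a) && (h' (p i.+1 j) != Some a))) => mv.
    have [_ _ /(_ isT) /= lt] := moved i.+1 j im jn mv.
    by case/andP: (q_le i j) => /leq_ltn_trans + _; apply.
  case/andP: (q_le i j) => /leq_ltn_trans + _; apply.
  by rewrite {1}/q (negPf mv); apply: Sp.
Qed.

(** This is the preceding argument backwards in time: an [a] that came from the right or from below
    returns there, and successors take the role of predecessors. All entries other than [a] agree in
    [h] and [h'], so the order of [h] still controls the boxes in between. *)
Lemma swapped_rectangle m n b : rectangle h' m n b -> rectangle h m n b.
Proof.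
have [_ swap_ab _ keep_b] := hh'.
case=> p [hp' Ep Sp].
have pD i j : (i <= m)%N -> (j <= n)%N -> p i j \in D.
  by move=> im jn; exact: h'D (hp' i j im jn).
have hp i j : (i <= m)%N -> (j <= n)%N -> a != (b + i%:Z + j%:Z)%R ->
    h (p i j) = Some (b + i%:Z + j%:Z)%R.
  by move=> im jn ne; apply/swapped_eq; rewrite ?hp' // eq_sym.
pose right_ok i j := let z := p i j in
  [&& (z.1, z.2.+1) \in D, h (z.1, z.2.+1) == Some a
    & (j == n) || (z.2.+1 < (p i j.+1).2)%N].
pose q i j : box := let z := p i j in
  if (h' z == Some a) && (h z != Some a) then
    if right_ok i j then (z.1, z.2.+1) else (z.1.+1, z.2)
  else z.
have diag_right i j : (i <= m)%N -> (j < n)%N -> a = (b + i%:Z + j%:Z)%R ->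
    h (p i j) = None -> ((p i j).1, (p i j).2.+1) \in D ->
    h ((p i j).1, (p i j).2.+1) = Some a ->
    (p i j.+1).2 = (p i j).2.+1 ->
    [/\ p i j.+1 = ((p i j).1.+1, (p i j).2.+1),
       ((p i j).1.+1, (p i j).2) \in D &
       h ((p i j).1.+1, (p i j).2) = Some a].
  move=> im jn ea; have := Ep i j im jn.
  have /(_ _) := hp i j.+1 im jn.
  have := pD i j.+1 im jn; have := pD i j im (ltnW jn).
  case: (p i j) => z1 z2; case: (p i j.+1) => y1 y2 /= zD yD + lt hz rD hr ey.
  have -> : a != (b + i%:Z + j.+1%:Z)%R by lia.
  move/(_ isT)=> hy.
  have z1y1 : (z1 < y1)%N.
    rewrite ltnNge; apply/negP => yz.
    have [e|ne] := eqVneq z1 y1.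
      by move: hr; rewrite e -ey hy => -[]; lia.
    have := h_incr yD rD; rewrite box_ltE /= hr hy /key => /(_ _) ; lia.
  have dD : (z1.+1, z2) \in D by apply: (Dconvex zD yD); rewrite box_leE /=; lia.
  have eD : (z1.+1, z2.+1) \in D by apply: (Dconvex zD yD); rewrite box_leE /=; lia.
  have hd : h (z1.+1, z2) = Some a.
    have := h_incr zD dD; have := h_incr dD yD; rewrite !box_ltE /= hy hz.
    case: (h _) => [u|] /(_ _) k1 /(_ _) k2; rewrite /key in k1 k2; try lia.
    by congr Some; lia.
  split=> //.
  have [->//|e] := eqVneq y1 z1.+1; first by rewrite ey.
  have := h_incr rD eD; have := h_incr eD yD; rewrite !box_ltE /= hy hr.
  by case: (h _) => [u|] /(_ _) k1 /(_ _) k2; rewrite /key in k1 k2; lia.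
have diag_down i j : (i < m)%N -> (j <= n)%N -> a = (b + i%:Z + j%:Z)%R ->
    h (p i j) = None -> ((p i j).1.+1, (p i j).2) \in D ->
    h ((p i j).1.+1, (p i j).2) = Some a ->
    (p i.+1 j).1 = (p i j).1.+1 ->
    [/\ p i.+1 j = ((p i j).1.+1, (p i j).2.+1),
       ((p i j).1, (p i j).2.+1) \in D &
       h ((p i j).1, (p i j).2.+1) = Some a].
  move=> im jn ea; have := Sp i j im jn.
  have /(_ _) := hp i.+1 j im jn.
  have := pD i.+1 j im jn; have := pD i j (ltnW im) jn.
  case: (p i j) => z1 z2; case: (p i.+1 j) => y1 y2 /= zD yD + lt hz dD hd ey.
  have -> : a != (b + i.+1%:Z + j%:Z)%R by lia.
  move/(_ isT)=> hy.
  have z2y2 : (z2 < y2)%N.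
    rewrite ltnNge; apply/negP => yz.
    have [e|ne] := eqVneq z2 y2.
      by move: hd; rewrite e -ey hy => -[]; lia.
    have := h_incr yD dD; rewrite box_ltE /= hd hy /key => /(_ _) ; lia.
  have rD : (z1, z2.+1) \in D by apply: (Dconvex zD yD); rewrite box_leE /=; lia.
  have eD : (z1.+1, z2.+1) \in D by apply: (Dconvex zD yD); rewrite box_leE /=; lia.
  have hr : h (z1, z2.+1) = Some a.
    have := h_incr zD rD; have := h_incr rD yD; rewrite !box_ltE /= hy hz.
    case: (h _) => [u|] /(_ _) k1 /(_ _) k2; rewrite /key in k1 k2; try lia.
    by congr Some; lia.
  split=> //.
  have [->//|e] := eqVneq y2 z2.+1; first by rewrite ey.
  have := h_incr dD eD; have := h_incr eD yD; rewrite !box_ltE /= hy hd.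
  by case: (h _) => [u|] /(_ _) k1 /(_ _) k2; rewrite /key in k1 k2; lia.
have not_both i j : (i < m)%N -> (j < n)%N -> a = (b + i%:Z + j%:Z)%R ->
    p i.+1 j <> p i j.+1.
  move=> im jn ea e; have := Ep i.+1 j im jn; have := Sp i j.+1 im jn.
  have /(_ _) := hp i.+1 j.+1 im jn; have /(_ _) := hp i j.+1 (ltnW im) jn.
  have := pD i.+1 j.+1 im jn; have := pD i j.+1 (ltnW im) jn.
  rewrite e; case: (p i.+1 j.+1) => x1 x2; case: (p i j.+1) => y1 y2 /= yD xD.
  have -> : a != (b + i%:Z + j.+1%:Z)%R by lia.
  have -> : a != (b + i.+1%:Z + j.+1%:Z)%R by lia.
  move=> /(_ isT) hy /(_ isT) hx lt1 lt2.
  have zD : (y1, x2) \in D by apply: (Dconvex yD xD); rewrite box_leE /=; lia.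
  have := h_incr yD zD; have := h_incr zD xD; rewrite !box_ltE /= hx hy.
  by case: (h _) => [u|] /(_ _) k1 /(_ _) k2; rewrite /key in k1 k2; lia.
have moved i j : (i <= m)%N -> (j <= n)%N ->
    (h' (p i j) == Some a) && (h (p i j) != Some a) ->
  [/\ h (q i j) = Some a, (j < n)%N -> ((q i j).2 < (p i j.+1).2)%N &
    (i < m)%N -> ((q i j).1 < (p i.+1 j).1)%N].
  move=> im jn mv; rewrite /q /= mv; case/andP: mv => /eqP h'z hza.
  have zD := h'D h'z.
  have ea : a = (b + i%:Z + j%:Z)%R by move: h'z; rewrite hp' // => -[].
  have hz : h (p i j) = None.
    by case: (swapped_cases zD) => [e|[e _]|[]] //; rewrite -?e ?h'z ?e eqxx in hza.
  case: (boolP (right_ok i j)) => [/and3P[rD /eqP hr ok]|nok].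
    split=> //=.
    - by move=> jn'; move: ok; rewrite eqn_leq [(n <= j)%N]leqNgt jn' andbF.
    - by move=> im'; exact: Sp.
  have [dD hd] : ((p i j).1.+1, (p i j).2) \in D /\
      h ((p i j).1.+1, (p i j).2) = Some a.
    case: (keep_b _ zD hz) => [e|[y [yD /coversP yz hy]]]; first by rewrite e in h'z.
    case: yz => ey; first by rewrite -ey.
    move: nok; rewrite /right_ok -ey yD hy eqxx /= => /norP[jn' lt].
    have {}jn' : (j < n)%N by rewrite ltn_neqAle jn'.
    rewrite ey in yD hy.
    have [|//] := diag_right i j im jn' ea hz yD hy.
    by apply/esym/succn_of_ltn; [exact: Ep | exact: lt].
  split=> //=.
  - by move=> jn'; exact: Ep.
  move=> im'; have lt_i := Sp i j im' jn.
  have [e|ne] := eqVneq ((p i j).1.+1 : nat) (p i.+1 j).1; last by rewrite ltn_neqAle ne.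
  have [ep rD hr] := diag_down i j im' jn ea hz dD hd (esym e).
  move: nok; rewrite /right_ok rD hr eqxx /= => /norP[jn' lt].
  have {}jn' : (j < n)%N by rewrite ltn_neqAle jn'.
  have [|ep' _ _] := diag_right i j im jn' ea hz rD hr.
    by apply/esym/succn_of_ltn; [exact: Ep | exact: lt].
  by case: (not_both i j im' jn' ea); rewrite ep ep'.
have q_ge i j : ((p i j).1 <= (q i j).1)%N && ((p i j).2 <= (q i j).2)%N.
  by rewrite /q; case: ifP => _; [case: ifP => _ /=; lia | lia].
exists q; split=> i j.
- move=> im jn; case: (boolP ((h' (p i j) == Some a) && (h (p i j) != Some a))) => mv.
    by have [-> _ _] := moved i j im jn mv; case/andP: mv => /eqP; rewrite hp'.
  rewrite /q (negPf mv); move: mv; rewrite hp' //.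
  have [e|ne] := eqVneq (Some (b + i%:Z + j%:Z)%R) (Some a).
    by rewrite /= negbK e => /eqP.
  by move=> _; apply: hp => //; apply: contraNneq ne => ->.
- move=> im jn.
  case: (boolP ((h' (p i j) == Some a) && (h (p i j) != Some a))) => mv.
    have [_ lt _] := moved i j im (ltnW jn) mv.
    by case/andP: (q_ge i j.+1) => _; apply: leq_trans; exact: lt.
  case/andP: (q_ge i j.+1) => _; apply: leq_trans.
  by rewrite {1}/q (negPf mv); apply: Ep.
- move=> im jn.
  case: (boolP ((h' (p i j) == Some a) && (h (p i j) != Some a))) => mv.
    have [_ _ lt] := moved i j (ltnW im) jn mv.
    by case/andP: (q_ge i.+1 j) => + _; apply: leq_trans; exact: lt.
  case/andP: (q_ge i.+1 j) => + _; apply: leq_trans.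
  by rewrite {1}/q (negPf mv); apply: Sp.
Qed.

End Swap.

(** * Slides as sequences of swaps *)

(** Bullets and boxes outside the domain both give [None], so adding or deleting bullets does not
    change the function. This is why [swapped] and [key_increasing] are relative to a set [D]. *)
Definition letter (Y : {fmap box -> option int}) (x : box) : option int :=
  ojoin Y.[? x].

Lemma letterE (Y : {fmap box -> option int}) (x : domf Y) : letter Y (val x) = Y x.
Proof. by rewrite /letter -Some_fnd. Qed.

Lemma letter_domf Y x v : letter Y x = Some v -> x \in domf Y.
Proof. by rewrite /letter; case: fndP. Qed.

Lemma has_neighborP (Y : {fmap box -> option int}) (x : domf Y) u :
  reflect (exists y : box, [/\ y \in domf Y, neighbors (val x) y & letter Y y = u])
          (has_neighbor x u).
Proof.
apply: (iffP existsP) => [[y /andP[/asboolP xy /eqP yu]]|[y [yD xy yu]]].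
  by exists (val y); rewrite fsvalP letterE.
by exists [` yD]; rewrite -letterE yu eqxx andbT; apply/asboolP.
Qed.

Lemma letter_swap a (Y : {fmap box -> option int}) (x : domf Y) :
  letter (swap (Some a) None Y) (val x) =
  if (Y x == Some a) && has_neighbor x None then None
  else if (Y x == None) && has_neighbor x (Some a) then Some a else Y x.
Proof. by rewrite -[val x]/(val (x : domf (swap (Some a) None Y))) letterE ffunE. Qed.

Lemma covers_lt (x y : box) : covers y x -> (x < y)%O.
Proof. by case. Qed.

(** Although [swap] looks at neighbors on both sides, the key order only permits a bullet below an
    [a], never above it. *)
Lemma swapped_swap a Y : convex (domf Y) -> key_increasing a (domf Y) (letter Y) ->
  swapped a (domf Y) (letter Y) (letter (swap (Some a) None Y)).
Proof.
move=> Yconvex Y_incr; split.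
- move=> x xD xa x0; have := @letter_swap a Y [` xD]; rewrite -!letterE /=.
  by move/eqP/negPf: xa => ->; move/eqP/negPf: x0 => ->.
- move=> x y xD yD xy hx hy.
  have cov : covers y x.
    split=> // -[z [xz zy]].
    have zD : z \in domf Y by apply: Yconvex xD yD _ _; exact: ltW.
    have := Y_incr _ _ xD zD xz; have := Y_incr _ _ zD yD zy.
    by rewrite hx hy; case: (letter Y z) => [v|]; rewrite /key; lia.
  have := @letter_swap a Y [` xD]; have := @letter_swap a Y [` yD] => /=.
  rewrite -!letterE /= hx hy eqxx /=.
  have -> : has_neighbor [` xD] (Some a).
    by apply/has_neighborP; exists y; split=> //=; left.
  have -> : has_neighbor [` yD] None.
    by apply/has_neighborP; exists x; split=> //=; right.
  by move=> -> ->.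
- move=> x xD hx.
  have := @letter_swap a Y [` xD]; rewrite -!letterE /= hx eqxx /= => ->.
  case: has_neighborP => [[y [yD xy hy]]|_]; last by left.
  right; exists y; split=> //; case: xy => // /covers_lt /= xy.
  by have := Y_incr _ _ xD yD xy; rewrite hx hy /key; lia.
move=> x xD hx.
have := @letter_swap a Y [` xD]; rewrite -!letterE /= hx /= => ->.
case: has_neighborP => [[y [yD xy hy]]|_]; last by left.
right; exists y; split=> //; case: xy => // /covers_lt /= xy.
by have := Y_incr _ _ yD xD xy; rewrite hx hy /key; lia.
Qed.

(** The parameter of the keys advances with the swaps: after [k] of them the bullets lie between
    [a + k - 1] and [a + k]. *)
Lemma foldl_swap a k Y : convex (domf Y) -> key_increasing a (domf Y) (letter Y) ->
  let Y' := foldl (fun Y i => swap (Some i) None Y) Y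
                  [seq (a + Posz i)%R | i <- iota 0 k] in
  [/\ domf Y' = domf Y, key_increasing (a + k%:Z)%R (domf Y) (letter Y') &
      forall m n b, rectangle (letter Y') m n b <-> rectangle (letter Y) m n b].
Proof.
move=> Yconvex Y_incr; elim: k => [|k]; cbv zeta; first by rewrite /= addr0.
rewrite -addn1 iotaD map_cat foldl_cat add0n /=.
set Y1 := foldl _ _ _; case=> dom1 incr1 pat1.
have sw : swapped (a + k%:Z)%R (domf Y) (letter Y1)
                  (letter (swap (Some (a + k%:Z)%R) None Y1)).
  by rewrite -dom1; apply: swapped_swap; rewrite dom1.
have hD x v : letter Y1 x = Some v -> x \in domf Y by move/letter_domf; rewrite dom1.
have h'D x v : letter (swap (Some (a + k%:Z)%R) None Y1) x = Some v -> x \in domf Y.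
  by move/letter_domf; rewrite dom1.
split=> //.
  by rewrite PoszD addrA; exact: key_increasing_swapped incr1 sw.
move=> m n b; rewrite -pat1; split.
  exact: (swapped_rectangle Yconvex hD h'D incr1 sw).
exact: (rectangle_swapped Yconvex hD h'D incr1 sw).
Qed.

(** Through this case, preservation of rectangles also says that a slide preserves the set of
    entries. *)
Lemma rectangle1 h v : rectangle h 0 0 v <-> exists x : box, h x = Some v.
Proof.
split=> [[p [/(_ 0%N 0%N isT isT) hp _ _]]|[x hx]].
  by exists (p 0%N 0%N); rewrite hp !addr0.
by exists (fun _ _ => x); split=> // -[|i] -[|j] // _ _; rewrite !addr0.
Qed.

(** * The invariant of rectification *)

Definition descending (h : box -> option int) :=
  forall m n b, rectangle h m n b ->
    (1 <= b)%R /\ ((1 < b)%R -> rectangle h m n (b - 1)%R).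

(** The outer shape is existential because it changes with each slide and only its being straight
    matters. [descending] speaks of rectangles alone, hence survives slides. *)
Definition good_tableau (lam : {fset box}) (T : {fmap box -> int}) :=
  [/\ straight_shape lam, increasing T, descending (fun x => T.[? x]) &
      exists2 nu, straight_shape nu & lam `<=` nu /\ domf T = nu `\` lam].

Lemma letter_add_bullets C T : letter (add_bullets C T) = fun x => T.[? x].
Proof.
apply/funext => x; rewrite /letter; case: fndP => [xD|] /=; first by rewrite ffunE.
by rewrite inE negb_or => /andP[xT _]; rewrite not_fnd.
Qed.

Lemma convex_skew nu lam : straight_shape nu -> straight_shape lam ->
  convex (nu `\` lam).
Proof.
move=> nus lams x y z; rewrite !inE => /andP[xl _] /andP[_ zn] xy yz.
by rewrite (nus _ _ yz zn) andbT; apply: contra xl; exact: lams.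
Qed.

Lemma increasing_fnd T : increasing T <->
  forall (x y : box) v w, (x < y)%O -> T.[? x] = Some v -> T.[? y] = Some w -> (v < w)%R.
Proof.
split=> [Ti x y v w xy|H x y xy].
  case: fndP => // xT [<-]; case: fndP => // yT [<-].
  exact: (Ti [` xT] [` yT]).
by apply: (H _ _ _ _ xy); rewrite -Some_fnd.
Qed.

Lemma good_tableau_jdt lam T : lam != fset0 -> good_tableau lam T ->
  good_tableau (lam `\` maximal_boxes lam) (jdt (maximal_boxes lam) T).
Proof.
move=> lam0 [lams Ti Td [nu nus [sub domT]]].
set C := maximal_boxes lam; set lam' := lam `\` C; set N := max_abs T.
have CP x : x \in C -> x \in lam /\ forall y, y \in lam -> ~~ (x < y)%O.
  rewrite !inE => /andP[xl /forallP xm]; split=> // y yl.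
  exact: (xm [` yl]).
have lam's : straight_shape lam'.
  move=> x y xy; rewrite !in_fsetD => /andP[yC yl].
  rewrite (lams _ _ xy yl) andbT; apply/negP => xC; have [_ /(_ y yl)] := CP x xC.
  move: xy; rewrite le_eqVlt => /orP[/eqP e|-> //].
  by rewrite e (negPf yC) in xC.
set Y := add_bullets C T.
have domY : domf Y = nu `\` lam'.
  apply/fsetP => x; rewrite /Y /= in_fsetU domT !in_fsetD.
  case: (boolP (x \in C)) => [/CP[xl _]|_] /=; last by rewrite orbF.
  by rewrite orbT (fsubsetP sub).
have YC x : x \in domf Y -> x \notin domf T -> x \in C.
  by rewrite /Y /= in_fsetU => /orP[->|].
have TN x v : T.[? x] = Some v -> (`|v| <= N)%N.
  case: fndP => // xT [<-].
  exact: (@leq_bigmax _ (fun x : domf T => `|T x|%N)).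
have Yc : convex (domf Y) by rewrite domY; exact: convex_skew.
(* Initially a bullet has key [-2N - 1], below every entry. No bullet lies above an entry since
   [lam] is an ideal, and distinct maximal boxes are incomparable. *)
have Yi : key_increasing (- Posz N)%R (domf Y) (letter Y).
  move=> x y xD yD xy; rewrite letter_add_bullets.
  have := TN x; have := TN y; move/increasing_fnd: Ti => /(_ x y _ _ xy).
  case: fndP => xT; case: fndP => yT; rewrite /key.
  - by move=> /(_ _ _ erefl erefl); lia.
  - have [yl _] := CP y (YC y yD yT); have := xT; rewrite {1}domT in_fsetD.
    by rewrite (lams _ _ (ltW xy) yl).
  - by move=> _ /(_ _ erefl) + _; lia.
  - have [yl _] := CP y (YC y yD yT); have [_ /(_ y yl)] := CP x (YC x xD xT).
    by rewrite xy.
have := foldl_swap (absz (Posz N - - Posz N)%R).+1 Yc Yi.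
rewrite /jdt /jdt_range -/N /int_range -/Y.
have -> : (- Posz N <= Posz N)%R by lia.
set Y' := foldl _ _ _ => -[domY' Y'i pat].
set T' := reducef Y'.
have fT' : (fun x => T'.[? x]) = letter Y'.
  by apply/funext => x; rewrite /T' fnd_reducef.
have Y'N x v : letter Y' x = Some v -> (`|v| <= N)%N.
  move=> hx; have /rectangle1/pat/rectangle1[y] : exists x, letter Y' x = Some v by exists x.
  by rewrite letter_add_bullets; exact: TN.
have T'D x v : T'.[? x] = Some v -> x \in domf Y.
  by rewrite -[_.[? x]]/((fun x => T'.[? x]) x) fT' => /letter_domf; rewrite domY'.
split=> //.
- apply/increasing_fnd => x y v w xy hx hy.
  have := Y'i x y (T'D _ _ hx) (T'D _ _ hy) xy.
  by rewrite -fT' hx hy /key; lia.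
- rewrite fT' => m n b /pat; rewrite letter_add_bullets => /Td[b1 H].
  by split=> // /H; rewrite -(letter_add_bullets C T) -/Y => /pat.
(* After the last swap a bullet has key [2N + 1], above every entry. So no bullet lies below an
   entry, and deleting the bullets leaves an ideal. *)
exists (lam' `|` domf T').
  move=> x y xy; rewrite !in_fsetU => /orP[yl|yT'].
    by rewrite (lam's _ _ xy yl).
  have [//|xl] := boolP (x \in lam'); rewrite orFb.
  have [w hy] : exists w, T'.[? y] = Some w by exists T'.[yT']; rewrite in_fnd.
  have yD := T'D _ _ hy.
  have xD : x \in domf Y.
    rewrite domY in_fsetD xl.
    by move: yD; rewrite domY in_fsetD => /andP[_]; exact: nus xy.
  move: xy; rewrite le_eqVlt => /orP[/eqP->//|xy].
  have := Y'i x y xD yD xy; rewrite -fT' hy; case: fndP => //= _.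
  have := Y'N y _ (etrans (esym (congr1 (@^~ y) fT')) hy); rewrite /key. lia.
split; first exact: fsubsetUl.
apply/fsetP => x; rewrite in_fsetD in_fsetU.
case: (boolP (x \in lam')) => //= xl; apply/negP => xT'.
have := T'D x _ (in_fnd xT'); rewrite domY in_fsetD xl.
by [].
Qed.

Lemma rect_good lam T : good_tableau lam T -> good_tableau fset0 (rect lam T).
Proof.
have [k] := ubnP #|` lam|; elim: k lam T => // k IH lam T lt good.
rewrite rectE; case: ifPn => [/eqP <- //|lam0].
apply: IH; last exact: good_tableau_jdt.
have /fset0Pn[x xm] := maximal_boxes_neq0 lam0.
have xl : x \in lam by move: xm; rewrite inE => /andP[].
rewrite -ltnS; apply: leq_trans lt; rewrite ltnS; apply: fproper_ltn_card.
rewrite /fproper fsubsetDl /=.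
by apply/negP => /fsubsetP/(_ x xl); rewrite in_fsetD xm.
Qed.

(** * Pushing down rectangles when each entry [v > 1] has [v - 1] to its left or above it *)

Section MinimalTableau.

Variable h : box -> option int.

Definition increasing_fun := forall (x y : box) v w,
  (x < y)%O -> h x = Some v -> h y = Some w -> (v < w)%R.

Definition convex_fun := forall (x y z : box) v w,
  h x = Some v -> h z = Some w -> (x <= y)%O -> (y <= z)%O -> exists u, h y = Some u.

Definition tight_fun := forall r c v, h (r, c) = Some v -> (1 <= v)%R /\
  ((1 < v)%R -> (0 < c)%N /\ h (r, c.-1) = Some (v - 1)%R \/
               (0 < r)%N /\ h (r.-1, c) = Some (v - 1)%R).

Hypotheses (h_incr : increasing_fun) (h_conv : convex_fun) (h_tight : tight_fun).

Lemma row_gap k r c v w :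
  h (r, c) = Some v -> h (r, c + k)%N = Some w -> (v + k%:Z <= w)%R.
Proof.
elim: k w => [|k IH] w hv hw; first by move: hw; rewrite addn0 hv => -[->]; lia.
have [||u hu] := h_conv (y := (r, (c + k)%N)) hv hw; rewrite ?box_leE /=; try lia.
have := IH u hv hu.
by have := h_incr _ hu hw; rewrite box_ltE /= => /(_ _); lia.
Qed.

Lemma row_inj r c c' v : h (r, c) = Some v -> h (r, c') = Some v -> c = c'.
Proof.
move=> hv hv'; have := h_incr _ hv hv'; have := h_incr _ hv' hv.
rewrite !box_ltE /= => /(_ _) k1 /(_ _) k2.
by have [e|e|//] := ltngtP c c'; [have := k2 _ | have := k1 _]; lia.
Qed.

Lemma col_inj r r' c v : h (r, c) = Some v -> h (r', c) = Some v -> r = r'.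
Proof.
move=> hv hv'; have := h_incr _ hv hv'; have := h_incr _ hv' hv.
rewrite !box_ltE /= => /(_ _) k1 /(_ _) k2.
by have [e|e|//] := ltngtP r r'; [have := k2 _ | have := k1 _]; lia.
Qed.

(** Testing the far end is enough: the row increases strictly, so the entries in between are forced
    to be consecutive. *)
Definition left_run r c (v : int) k :=
  (k <= c)%N && (h (r, c - k)%N == Some (v - k%:Z)%R).

Lemma left_run_left r c v k : h (r, c) = Some v -> left_run r c v k.+1 ->
  [/\ (0 < c)%N, h (r, c.-1) = Some (v - 1)%R & left_run r c.-1 (v - 1) k].
Proof.
move=> hv /andP[kc /eqP hk].
have [||u hu] := h_conv (y := (r, c.-1)) hk hv; rewrite ?box_leE /=; try lia.
have e1 : (c = c.-1 + 1)%N by lia.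
have e2 : (c.-1 = (c - k.+1) + k)%N by lia.
have := row_gap (k := 1) (c := c.-1) hu; rewrite -e1 => /(_ _ hv) g1.
have := row_gap (k := k) hk; rewrite -e2 => /(_ _ hu) g2.
have -> : (v - 1)%R = u by lia.
split=> //; first by lia.
apply/andP; split; first by lia.
have -> : (c.-1 - k = c - k.+1)%N by lia.
by rewrite hk; apply/eqP; congr Some; lia.
Qed.

(** Step left as long as possible. If a box of the run has its predecessor above instead, the box
    above the previous one is squeezed between [v - 2] and [v], and so the upward step propagates
    back to the start. *)
Lemma left_run_or_up k r c v : h (r, c) = Some v -> (k%:Z < v)%R ->
  left_run r c v k \/ (0 < r)%N /\ h (r.-1, c) = Some (v - 1)%R.
Proof.
elim: k r c v => [|k IH] r c v hv kv.
  by left; rewrite /left_run /= subn0 hv subr0.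
have [_ /(_ _)[|[c0 hl]|]] := h_tight hv; [lia | | by right].
have [|/andP[kc /eqP hk]|[r0 hd]] := IH _ _ _ hl; first by lia.
  left; apply/andP; split; first by lia.
  have -> : (c - k.+1 = c.-1 - k)%N by lia.
  by rewrite hk; apply/eqP; congr Some; lia.
right; split=> //.
have [||u hu] := h_conv (y := (r.-1, c)) hd hv; rewrite ?box_leE /=; try lia.
have := h_incr _ hd hu; have := h_incr _ hu hv; rewrite !box_ltE /= => /(_ _) k1 /(_ _) k2.
by rewrite hu; congr Some; lia.
Qed.

Lemma left_run_below r c v k : h (r, c) = Some v -> h (r.+1, c) = Some (v + 1)%R ->
  left_run r c v k -> left_run r.+1 c (v + 1) k.
Proof.
move=> hv hw /andP[kc /eqP hk]; rewrite /left_run kc /=.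
have [||u hu] := h_conv (y := (r.+1, c - k)%N) hk hw; rewrite ?box_leE /=; try lia.
have := h_incr _ hk hu; rewrite box_ltE /= => /(_ _) k1.
have := row_gap (k := k) hu; rewrite subnK // => /(_ _ hw) k2.
by rewrite hu; apply/eqP; congr Some; lia.
Qed.

(* The box in position (i, j) moves left if j + 1 steps to the left each lower
   the entry by one, and up otherwise. *)
Lemma tight_descending : descending h.
Proof.
move=> m n b [p [hp Ep Sp]].
have hp' i j : (i <= m)%N -> (j <= n)%N ->
    h ((p i j).1, (p i j).2) = Some (b + i%:Z + j%:Z)%R.
  by move=> im jn; rewrite -hp //; case: (p i j).
split=> [|b1].
  by have [] := h_tight (hp' 0%N 0%N isT isT); rewrite !addr0.
(* Since [b > 1], the entry exceeds [j + 1], as [left_run_or_up] requires. The length grows with [j]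
   so that a run at [j + 1] contains one at [j]. *)
pose run i j := left_run (p i j).1 (p i j).2 (b + i%:Z + j%:Z) j.+1.
pose q i j : box := if run i j then ((p i j).1, (p i j).2.-1) else ((p i j).1.-1, (p i j).2).
have up i j : (i <= m)%N -> (j <= n)%N -> ~~ run i j ->
    (0 < (p i j).1)%N /\ h ((p i j).1.-1, (p i j).2) = Some (b + i%:Z + j%:Z - 1)%R.
  move=> im jn nrun.
  by case: (left_run_or_up (k := j.+1) (hp' i j im jn)); [lia | rewrite -/(run i j) (negPf nrun) | ].
exists q; split=> i j im jn; rewrite /q.
- have -> : (b - 1 + i%:Z + j%:Z = b + i%:Z + j%:Z - 1)%R by lia.
  case: ifPn => [/(left_run_left (hp' i j im jn))[]//|nrun].
  by have [] := up i j im jn nrun.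
- have := hp' i j.+1 im jn; have := hp' i j im (ltnW jn); have := Ep i j im jn.
  rewrite /run; case: (p i j) => r c; case: (p i j.+1) => r' c' /= lt hv hv'.
  case: ifPn => [/andP[c0 _]|nrun]; case: ifPn => [run1|_] /=; try lia.
  have [_ hl rl] := left_run_left hv' run1.
  (* Otherwise the left neighbor of [p i j.+1] has the entry and the column of [p i j]. Then it is
     that box, and the longer run gives [p i j] a run as well. *)
  rewrite ltnNge; apply: contra nrun => le.
  have ec : c'.-1 = c by lia.
  have ev : (b + i%:Z + j.+1%:Z - 1 = b + i%:Z + j%:Z)%R by lia.
  rewrite ec ev in hl rl; by rewrite (col_inj hv hl).
- have := hp' i.+1 j im jn; have := hp' i j (ltnW im) jn; have := Sp i j im jn.
  have := up i.+1 j im jn; have := up i j (ltnW im) jn.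
  rewrite /run; case: (p i j) => r c; case: (p i.+1 j) => r' c' /= up0 up1 lt hv hv'.
  case: ifPn => [run0|/up0[r0 _]]; case: ifPn => [run1|nrun1] /=; try lia.
  have [r'0 hu] := up1 nrun1.
  (* Otherwise the box above [p i.+1 j] has the entry and the row of [p i j]. Then it is that box,
     and its run forces one in the row below. *)
  rewrite ltnNge; apply: contra nrun1 => le.
  have er : r'.-1 = r by lia.
  have ev : (b + i.+1%:Z + j%:Z - 1 = b + i%:Z + j%:Z)%R by lia.
  have ev' : (b + i.+1%:Z + j%:Z = b + i%:Z + j%:Z + 1)%R by lia.
  rewrite er ev in hu; rewrite -(row_inj hv hu) ev'.
  rewrite ev' -(row_inj hv hu) -(prednK r'0) er in hv'.
  by rewrite -(prednK r'0) er; exact: left_run_below.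
Qed.

End MinimalTableau.

(** * Longest chains and the entries of a minimal tableau *)

Lemma chain_sub (C C' : {fset box}) : C' `<=` C -> chain C -> chain C'.
Proof.
move=> /fsubsetP sub chC; apply/forallP => x; apply/forallP => y.
exact: (forallP (forallP chC [` sub _ (fsvalP x)]) [` sub _ (fsvalP y)]).
Qed.

Lemma chain_largest (C : {fset box}) : chain C -> C != fset0 ->
  exists x : box, largest x C.
Proof.
move=> chC /fset0Pn[x0 x0C].
pose f (x : C) := ((val x).1 + (val x).2)%N.
case: (arg_maxnP f (isT : xpredT [` x0C])) => x _ xmax; exists (val x).
rewrite /largest fsvalP; apply/forallP => y.
have cmp := forallP (forallP chC y) x; rewrite comparable_leNgt //.
case: (boolP (_ < _)%O) => //; rewrite box_ltE => /and3P[_ _ lt].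
by have := leq_ltn_trans (xmax y isT) lt; rewrite ltnn.
Qed.

Section MinTableau.

Variables nu lam : {fset box}.
Hypotheses (nus : straight_shape nu) (lams : straight_shape lam).

Let D := nu `\` lam.
Let T := min_tableau nu lam.
Let len (x : box) : nat := \max_(C <- fpowerset D | chain C && largest x C) #|` C|.

Lemma min_tableauE x v : T.[? x] = Some v <-> x \in D /\ v = Posz (len x).
Proof.
case: fndP => [xT|xT]; last first.
  by split=> // -[xD]; case/negP: xT.
rewrite ffunE /=; split=> [[<-]|[_ ->//]]; by split.
Qed.

Lemma leq_len (C : {fset box}) x : C `<=` D -> chain C -> largest x C -> (#|` C| <= len x)%N.
Proof.
move=> CD chC lC; apply: leq_bigmax_seq; first by rewrite fpowersetE.
by rewrite chC lC.
Qed.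

Lemma len_gt0 x : x \in D -> (0 < len x)%N.
Proof.
have only (y : [fset x]) : val y = x by exact/fset1P/fsvalP.
move=> xD; rewrite -(cardfs1 x); apply: leq_len; first by rewrite fsub1set.
  apply/forallP => y; apply/forallP => z.
  by rewrite !only comparablexx.
by rewrite /largest inE eqxx; apply/forallP => y; rewrite only.
Qed.

Lemma min_tableau_incr : increasing_fun (fun x => T.[? x]).
Proof. by apply/increasing_fnd; exact: increasing_min_tableau. Qed.

Lemma len_lt (x y : box) : x \in D -> y \in D -> (x < y)%O -> (len x < len y)%N.
Proof.
move=> xD yD xy; have := min_tableau_incr xy (v := Posz (len x)) (w := Posz (len y)).
by rewrite ltz_nat; apply; apply/min_tableauE.
Qed.

Lemma min_tableau_conv : convex_fun (fun x => T.[? x]).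
Proof.
move=> x y z v w /min_tableauE[xD _] /min_tableauE[zD _] xy yz.
exists (Posz (len y)); apply/min_tableauE; split=> //.
exact: (convex_skew nus lams xD zD xy yz).
Qed.

(** Remove [x] from a chain ending at [x]. What remains, if nonempty, ends weakly below some box
    covered by [x], which is in [D] by convexity and has chains at least as long. *)
Lemma len_pred (x : box) : x \in D -> (1 < len x)%N ->
  exists y : box, [/\ y \in D, covers x y & (len x <= (len y).+1)%N].
Proof.
move=> xD x1; apply: contrapT => no.
suff : (len x <= (len x).-1)%N by move: x1; lia.
apply/bigmax_leqP_seq => C; rewrite fpowersetE => CD /andP[chC /andP[xC /forallP Cx]].
have ch' := chain_sub (fsubD1set C x) chC.
have := cardfsD1 x C; rewrite xC add1n => ->.
have [->|C0] := eqVneq (C `\ x) fset0; first by rewrite cardfs0; lia.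
have [y ly] := chain_largest ch' C0.
have yC : y \in C `\ x by case/andP: ly.
have yx : (y < x)%O.
  move: yC; rewrite in_fsetD1 => /andP[ne yC].
  by rewrite lt_neqAle ne; exact: (Cx [` yC]).
have yD : y \in D.
  by apply: (fsubsetP CD); move: yC; rewrite in_fsetD1 => /andP[].
have le_y : (#|` C `\ x| <= len y)%N.
  by apply: leq_len; rewrite // (fsubset_trans (fsubD1set C x)).
have [z [yz xz]] : exists z : box, (y <= z)%O /\ covers x z.
  move: yx; rewrite box_ltE; case: (x) (y) => [r c] [r' c'] /= /and3P[rr cc lt].
  have [lt_c|ge_c] := ltnP c' c.
    exists (r, c.-1); rewrite box_leE /=; split; first lia.
    by apply/coversP; right => /=; congr pair; lia.
  exists (r.-1, c); rewrite box_leE /=; split; first lia.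
  by apply/coversP; left => /=; congr pair; lia.
have zx := covers_lt xz.
have zD : z \in D by exact: (convex_skew nus lams yD xD yz (ltW zx)).
have le_yz : (len y <= len z)%N.
  move: yz; rewrite le_eqVlt => /orP[/eqP->//|yz].
  exact/ltnW/len_lt.
have lt_zx : ((len z).+1 < len x)%N.
  by rewrite ltnNge; apply/negP => le; apply: no; exists z.
by lia.
Qed.

Lemma min_tableau_tight : tight_fun (fun x => T.[? x]).
Proof.
move=> r c v /min_tableauE[xD ->]; split; first by have := len_gt0 xD; lia.
move=> lt1; have [|y [yD xy le]] := len_pred xD; first by lia.
have eq_y : (Posz (len (r, c)) - 1)%R = Posz (len y).
  by have := len_lt yD xD (covers_lt xy); lia.
case/coversP: xy => e; [right | left]; case: y e yD le eq_y => r' c' /= [-> ->] yD le eq_y.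
- by split=> //=; apply/min_tableauE.
- by split=> //=; apply/min_tableauE.
Qed.

End MinTableau.

Lemma good_min_tableau nu lam : skew_shape nu lam ->
  good_tableau lam (min_tableau nu lam).
Proof.
case=> nus lams sub; split=> //; first exact: increasing_min_tableau.
- apply: tight_descending; first exact: min_tableau_incr.
  + exact: min_tableau_conv.
  + exact: min_tableau_tight.
by exists nu.
Qed.

(** * Entries on straight shapes *)

Section StraightShape.

Variable T : {fmap box -> int}.
Hypotheses (Ts : straight_shape (domf T)) (T_incr : increasing_fun (fun x => T.[? x])).

Lemma straight_fnd (x y : box) v : (x <= y)%O -> T.[? y] = Some v ->
  exists w, T.[? x] = Some w.
Proof.
move=> xy hy; have yT : y \in domf T by move: hy; case: fndP.
by exists T.[Ts xy yT]; exact: in_fnd.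
Qed.

Lemma rank_le r c v : (forall x w, T.[? x] = Some w -> (1 <= w)%R) ->
  T.[? ((r, c) : box)] = Some v -> (Posz (r + c)%N < v)%R.
Proof.
move=> T1; have [k] := ubnP (r + c)%N; elim: k r c v => // k IH r c v lt hv.
have [e0|gt0] := posnP (r + c)%N; first by have := T1 _ _ hv; lia.
have [y [yr lt_y ey]] : exists y : box, [/\ (y < ((r, c) : box))%O,
    (y.1 + y.2 < k)%N & (y.1 + y.2).+1 = (r + c)%N].
  case: c gt0 lt {hv} => [|c] gt0 lt.
    by exists (r.-1, 0%N); rewrite box_ltE /=; split; lia.
  by exists (r, c); rewrite box_ltE /=; split; lia.
have [w hw] := straight_fnd (ltW yr) hv.
have := T_incr yr hw hv.
by case: y yr lt_y ey hw => r' c' /= yr lt_y ey /(IH _ _ _ lt_y); lia.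
Qed.

Lemma tight_rank r c v : tight_fun (fun x => T.[? x]) ->
  T.[? ((r, c) : box)] = Some v -> v = Posz (r + c)%N.+1.
Proof.
move=> tgt hv; apply/eqP; rewrite eq_le; apply/andP; split; last first.
  have T1 (x : box) w : T.[? x] = Some w -> (1 <= w)%R by case: x => a b /tgt[].
  by have := rank_le T1 hv; lia.
have [k] := ubnP (r + c)%N; elim: k r c v hv => // k IH r c v hv lt.
have [v1 step] := tgt _ _ _ hv.
have [|/step[[c0 hl]|[r0 hu]]] := leP v 1; first by lia.
  by have := IH _ _ _ hl; lia.
by have := IH _ _ _ hu; lia.
Qed.

(** Take for [k] the successor of the last index satisfying [P], or 0 if there is none. *)
Lemma last_below (P : nat -> Prop) n : exists k,
  [/\ (k <= n)%N, (0 < k)%N -> P k.-1 & forall i, (i < n)%N -> P i -> (i < k)%N].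
Proof.
elim: n => [|n [k [kn kP below]]]; first by exists 0%N; split.
have [Pn|nPn] := pselect (P n); first by exists n.+1; split.
exists k; split=> // [|i]; first exact: leqW.
by rewrite ltnS leq_eqVlt => /orP[/eqP->//|]; exact: below.
Qed.

(* Let K be the smallest entry that is not on its antidiagonal, at (r, c).  The
   nearest entries K - 1 on either side of (r, c) are in row rho - 1 and in
   column gamma - 1.  Row segments above (r, c) together with one below it and
   (r, c) itself form a rectangle whose largest entry is K, but there is no such
   rectangle with largest entry K - 1. *)
Lemma descending_rank r c v : descending (fun x => T.[? x]) ->
  T.[? ((r, c) : box)] = Some v -> v = Posz (r + c)%N.+1.
Proof.
move=> Td.
have T1 x w : T.[? x] = Some w -> (1 <= w)%R.
  by move=> hx; have /Td[] : rectangle (fun x => T.[? x]) 0 0 w by apply/rectangle1; exists x.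
have [k] := ubnP `|v|%N; elim: k r c v => // k IHk r c v lt_k hv.
have IH r' c' v' : (v' < v)%R -> T.[? ((r', c') : box)] = Some v' -> v' = Posz (r' + c')%N.+1.
  by move=> v'v hv'; apply: (IHk _ _ _ _ hv'); have := T1 _ _ hv'; lia.
have := rank_le T1 hv; have [//|ne lt_v] := eqVneq v (Posz (r + c)%N.+1).
have {}lt_v : (Posz (r + c)%N.+1 < v)%R by lia.
have [K eK] : exists K : nat, v = Posz K by exists `|v|%N; lia.
subst v.
have [rho [rho_r rhoP rho_max]] :=
  last_below (fun i => exists j, T.[? ((i, j) : box)] = Some (Posz K - 1)%R) r.
have [gam [gam_c gamP gam_max]] :=
  last_below (fun j => exists i, T.[? ((i, j) : box)] = Some (Posz K - 1)%R) c.
(* With this offset a rectangle starting at [e + 1] has largest entry [K]. It is positive because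
   [rho <= r], [gam <= c] and [r + c + 1 < K], so the rectangle can be pushed down. *)
pose e := (K - rho - gam - 1)%N.
have eE : (K = e + rho + gam + 1)%N by rewrite /e; lia.
have e1 : (1 <= e)%N by rewrite /e; lia.
have sub (x : box) r' c' : (x <= ((r', c') : box))%O ->
    T.[? ((r', c') : box)] = Some (Posz K - 1)%R -> T.[? x] = Some (Posz (x.1 + x.2)%N.+1).
  move=> xy hy; have [w hw] := straight_fnd xy hy.
  have lt_w : (w < Posz K)%R.
    move: xy; rewrite le_eqVlt => /orP[/eqP ex|xy].
      by move: hw; rewrite ex hy => -[<-]; lia.
    by have := T_incr xy hw hy; lia.
  by case: x {xy} hw => a b hw; rewrite hw (IH _ _ _ lt_w hw).
pose p i j : box := if (i < rho)%N then (i, (j + e)%N)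
                    else if (j < gam)%N then ((e + rho)%N, j) else (r, c).
have pat : rectangle (fun x => T.[? x]) rho gam (Posz e + 1)%R.
  exists p; split=> i j; rewrite /p.
  - move=> ir jg; case: ifPn => [lt_i|ge_i].
      (* The entry [K - 1] in row [rho - 1] is on its antidiagonal, hence in column [e + gam]. So
         the row segments used lie weakly below it in the order. *)
      have [c' hc'] := rhoP ltac:(lia).
      have := IH _ _ _ _ hc' => /(_ _) ec'.
      by rewrite (sub (i, (j + e)%N) _ _ _ hc') ?box_leE /=; [congr Some|]; lia.
    case: ifPn => [lt_j|ge_j].
      have [r' hr'] := gamP ltac:(lia).
      have := IH _ _ _ _ hr' => /(_ _) er'.
      by rewrite (sub ((e + rho)%N, j) _ _ _ hr') ?box_leE /=; [congr Some|]; lia.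
    by rewrite hv; congr Some; lia.
  - by move=> ir jg; do !case: ifPn => /=; lia.
  - by move=> ir jg; do !case: ifPn => /=; lia.
have [_ /(_ _)[|q [hq Eq Sq]]] := Td _ _ _ pat; first by lia.
(* The last box of the pushed rectangle contains [K - 1] and lies in row at least [rho] and column
   at least [gam]. By the choice of [rho] and [gam] it is then weakly above [(r, c)] in the order,
   although [(r, c)] contains [K]. *)
have row_ge i : (i <= rho)%N -> (i <= (q i gam).1)%N.
  elim: i => // i IHi lt_i; have := Sq i gam lt_i (leqnn _).
  by apply: leq_ltn_trans; apply: IHi; exact: ltnW.
have col_ge j : (j <= gam)%N -> (j <= (q rho j).2)%N.
  elim: j => // j IHj lt_j; have := Eq rho j (leqnn _) lt_j.
  by apply: leq_ltn_trans; apply: IHj; exact: ltnW.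
have := row_ge rho (leqnn _); have := col_ge gam (leqnn _).
have := hq rho gam (leqnn _) (leqnn _).
case: (q rho gam) => r' c' /= hz ge_c ge_r.
have {}hz : T.[? ((r', c') : box)] = Some (Posz K - 1)%R by rewrite hz; congr Some; lia.
have [lt_r|ge_r'] := ltnP r' r.
  by have := rho_max r' lt_r (ex_intro _ c' hz); lia.
have [lt_c|ge_c'] := ltnP c' c.
  by have := gam_max c' lt_c (ex_intro _ r' hz); lia.
have [e'|ne'] := eqVneq ((r, c) : box) (r', c').
  by move: hz; rewrite -e' hv => -[]; lia.
have := T_incr _ hv hz; rewrite lt_neqAle ne' box_leE /= ge_r' ge_c' => /(_ isT).
by lia.
Qed.

End StraightShape.

(** * Comparison with the minimal tableau of the rectified shape *)

Theorem theorem6p15 (nu lam : {fset box}) (Hskew : skew_shape nu lam) :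
  exists mu : {fset box},
    straight_shape mu /\ rect lam (min_tableau nu lam) = min_tableau mu fset0.
Proof.
have := rect_good (good_min_tableau Hskew).
set R := rect _ _; case=> s0 Ri Rd [mu mus [_ domR]].
rewrite fsetD0 in domR; exists mu; split=> //.
have Rs : straight_shape (domf R) by rewrite domR.
have mu0 : skew_shape mu fset0 by split; rewrite ?fsub0set.
set M := min_tableau mu fset0.
have domM : domf M = mu by rewrite /= fsetD0.
have Ms : straight_shape (domf M) by rewrite domM.
have M_incr := min_tableau_incr (nu := mu) (lam := fset0).
apply/fmapP => -[r c].
have : (((r, c) : box) \in domf R) = ((r, c) \in domf M) by rewrite domR domM.
case: fndP => hR; case: fndP => hM; rewrite ?(negPf hR) ?(negPf hM) ?hR ?hM //.
move=> _; congr Some.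
(* Both entries equal [r + c + 1]. *)
have := descending_rank Rs (iffLR (increasing_fnd R) Ri) Rd (in_fnd hR).
have := tight_rank Ms M_incr (min_tableau_tight mus s0) (in_fnd hM).
by move=> -> ->.
Qed.
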